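(* For any $m,q,n\in\mathbb{N}$ with $n\ge q+m-1$, any integer $p\in[0,m]$, and any sequences of complex numbers $a_{(1);N},\ldots,a_{(m);N}$ defined for integers $N$ in $[q,n+1]$, $$P_{m,q,n+1}=a_{(m);n+1}\Big\{a_{(m-1);n}\Big[\cdots a_{(p+2);n-m+p+3}\big(a_{(p+1);n-m+p+2}(P_{p,q,n-m+p+1})+P_{p+1,q,n-m+p+1}\big)+P_{p+2,q,n-m+p+2}\Big]+P_{m-1,q,n-1}\Big\}+P_{m,q,n}.$$ The nested expression on the right means $E_m$, where $E_p=P_{p,q,n-m+p+1}$ and $E_k=a_{(k);\,n-m+k+1}\,E_{k-1}+P_{k,q,n-m+k}$ for $p+1\le k\le m$.
   Context: $\mathbb{N}=\{0,1,2,\ldots\}$. For given sequences, $P_{k,q,M}=\sum_{q\le N_1<\cdots<N_k\le M}a_{(k);N_k}\cdots a_{(2);N_2}a_{(1);N_1}$ is the multiple sum of order $k$ over all strictly increasing $k$-tuples of integers in $[q,M]$. It uses the first $k$ sequences. For $k=0$ it equals $1$ whatever its bounds; for $k\ge1$ it equals $0$ when there are no such tuples. *)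

(* Defs.v *)
From HB Require Import structures.
From mathcomp Require Import all_boot all_order all_algebra.
From mathcomp Require Import reals complex.

Set Implicit Arguments.
Unset Strict Implicit.
Unset Printing Implicit Defensive.

Import GRing.Theory.
Local Open Scope ring_scope.

(* P_{k,q,M}. The sequence a_{(j)} is [a j], with j starting at 1, so [a 0] is
   never used; the index N_(i+1) of the k-tuple is [N i]. *)
Definition multiple_sum (C : comNzRingType) (a : nat -> nat -> C)
    (k q M : nat) : C :=
  \sum_(N : {ffun 'I_k -> 'I_M.+1} |
          [forall i, q <= N i]%N &&
          [forall i : 'I_k, forall j : 'I_k, (i < j)%N ==> (N i < N j)%N])
     \prod_(i < k) a i.+1 (N i).

(* [nested_sum a m q n p d] is the level E_{p+d} of the nested expression:
     E_p = P_{p,q,n-m+p+1},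
     E_k = a_{(k);n-m+k+1} E_{k-1} + P_{k,q,n-m+k}   for k > p.
   The integer n - m + 1 is written [n.+1 - m]; the truncated subtraction is
   exact when m <= n + 1, whereas [n - m] would be wrong for n = m - 1. *)
Fixpoint nested_sum (C : comNzRingType) (a : nat -> nat -> C)
    (m q n p d : nat) : C :=
  if d is d'.+1 then
    let k := (p + d')%N.+1 in
    a k (n.+1 - m + k)%N * nested_sum a m q n p d'
      + multiple_sum a k q (n.+1 - m + k.-1)%N
  else multiple_sum a p q (n.+1 - m + p)%N.

(* Main.v *)
Require Import Defs.
From mathcomp Require Import all_boot all_order all_algebra.
From mathcomp Require Import reals complex.

(** The nested expression is a Horner-like unfolding of a Pascal-type recurrence
    in the upper bound:
      P_{k+1,q,M+1} = a_{(k+1);M+1} P_{k,q,M} + P_{k+1,q,M}   (q <= M + 1).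
    An increasing (k+1)-tuple in [q, M+1] either ends at M+1, and is then an
    increasing k-tuple in [q, M] followed by M+1, or stays in [q, M]
    ([multiple_sum_recr]).  The bounds in the nested expression are chosen so
    that each level is the right-hand side of this recurrence: by induction
    from the innermost level, E_k collapses to the single sum P_{k,q,n-m+k+1}
    ([nested_sumE]), and the outermost level k = m is P_{m,q,n+1}. *)

Import GRing.Theory.
Local Open Scope ring_scope.
Local Open Scope complex_scope.

Definition increasing_from (q k M : nat) (N : {ffun 'I_k -> 'I_M.+1}) : bool :=
  [forall i, q <= N i]%N &&
  [forall i : 'I_k, forall j : 'I_k, (i < j)%N ==> (N i < N j)%N].

Lemma increasing_fromP (q k M : nat) (N : {ffun 'I_k -> 'I_M.+1}) :
  reflect ((forall i, (q <= N i)%N) /\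
           (forall i j : 'I_k, (i < j)%N -> (N i < N j)%N))
          (increasing_from q k M N).
Proof.
apply: (iffP andP) => -[/forallP qN incN]; split=> //.
  by move=> i j lt_ij; move/forallP/(_ i)/forallP/(_ j)/implyP: incN; apply.
apply/forallP=> i; apply/forallP=> j; apply/implyP; exact: incN.
Qed.

Definition tuple_widen (k M : nat) (N : {ffun 'I_k -> 'I_M.+1}) :
    {ffun 'I_k -> 'I_M.+2} :=
  [ffun i => widen_ord (leqnSn M.+1) (N i)].

(** On values equal to M+1 the result is the arbitrary value 0 given by
    [inord]; it is only meant for tuples bounded by M. *)
Definition tuple_narrow (k M : nat) (N : {ffun 'I_k -> 'I_M.+2}) :
    {ffun 'I_k -> 'I_M.+1} :=
  [ffun i => inord (N i)].

Definition tuple_rcons_max (k M : nat) (N : {ffun 'I_k -> 'I_M.+1}) :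
    {ffun 'I_k.+1 -> 'I_M.+2} :=
  [ffun i => if unlift ord_max i is Some j
             then widen_ord (leqnSn M.+1) (N j) else ord_max].

Definition tuple_belast (k M : nat) (N : {ffun 'I_k.+1 -> 'I_M.+2}) :
    {ffun 'I_k -> 'I_M.+1} :=
  [ffun j => inord (N (lift ord_max j))].

Lemma tuple_rcons_max_lift (k M : nat) (N : {ffun 'I_k -> 'I_M.+1}) j :
  tuple_rcons_max k M N (lift ord_max j) = N j :> nat.
Proof. by rewrite ffunE liftK. Qed.

Lemma tuple_rcons_max_last (k M : nat) (N : {ffun 'I_k -> 'I_M.+1}) :
  tuple_rcons_max k M N ord_max = ord_max.
Proof. by rewrite ffunE unlift_none. Qed.

Lemma tuple_widenK k M : cancel (tuple_widen k M) (tuple_narrow k M).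
Proof. by move=> N; apply/ffunP=> i; rewrite !ffunE /= inord_val. Qed.

Lemma tuple_rcons_maxK k M : cancel (tuple_rcons_max k M) (tuple_belast k M).
Proof.
by move=> N; apply/ffunP=> j; rewrite ffunE tuple_rcons_max_lift inord_val.
Qed.

Lemma lt_lift_max (k : nat) (j : 'I_k) :
  (lift ord_max j < (ord_max : 'I_k.+1))%N.
Proof. by rewrite lift_max /=. Qed.

Lemma tuple_belastK (q k M : nat) (N : {ffun 'I_k.+1 -> 'I_M.+2}) :
  increasing_from q k.+1 M.+1 N -> N ord_max = ord_max ->
  tuple_rcons_max k M (tuple_belast k M N) = N.
Proof.
case/increasing_fromP=> _ incN lastN; apply/ffunP=> i; apply/val_inj.
case: (unliftP ord_max i) => [j|] ->; last by rewrite tuple_rcons_max_last lastN.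
have := incN _ _ (lt_lift_max _ j); rewrite lastN /= => ltM.
by rewrite tuple_rcons_max_lift ffunE inordK.
Qed.

(** By monotonicity it is enough that the last value differs from M+1. *)
Lemma tuple_narrowK (q k M : nat) (N : {ffun 'I_k.+1 -> 'I_M.+2}) :
  increasing_from q k.+1 M.+1 N -> N ord_max != ord_max ->
  tuple_widen k.+1 M (tuple_narrow k.+1 M N) = N.
Proof.
case/increasing_fromP=> _ incN lastN; apply/ffunP=> i; apply/val_inj.
have ltM : (N ord_max < M.+1)%N.
  by rewrite ltn_neqAle -[X in (_ <= X)%N]/(M.+1) -ltnS ltn_ord andbT.
rewrite !ffunE /= inordK //.
case: (unliftP ord_max i) => [j|] -> //.
exact: ltn_trans (incN _ _ (lt_lift_max _ j)) ltM.
Qed.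

Lemma increasing_widen (q k M : nat) (N : {ffun 'I_k -> 'I_M.+1}) :
  increasing_from q k M.+1 (tuple_widen k M N) = increasing_from q k M N.
Proof.
by apply/increasing_fromP/increasing_fromP=> -[qN incN]; split=> [i|i j ltij];
  [have := qN i | have := incN i j ltij | have := qN i | have := incN i j ltij];
  rewrite !ffunE.
Qed.

(** The hypothesis on [q] makes the appended value M+1 admissible. *)
Lemma increasing_rcons_max (q k M : nat) (N : {ffun 'I_k -> 'I_M.+1}) :
  (q <= M.+1)%N ->
  increasing_from q k.+1 M.+1 (tuple_rcons_max k M N) = increasing_from q k M N.
Proof.
move=> leqM; apply/increasing_fromP/increasing_fromP=> -[qN incN]; split.
- by move=> j; rewrite -tuple_rcons_max_lift.
- move=> i j lt_ij; rewrite -!(tuple_rcons_max_lift k M N).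
  by apply: incN; rewrite !lift_max.
- move=> i; case: (unliftP ord_max i) => [j|] ->.
    by rewrite tuple_rcons_max_lift.
  by rewrite tuple_rcons_max_last.
- move=> i j; case: (unliftP ord_max i) => [i'|] ->; last first.
    by rewrite ltnNge -ltnS ltn_ord.
  case: (unliftP ord_max j) => [j'|] ->.
    by rewrite !lift_max !tuple_rcons_max_lift; exact: incN.
  by rewrite tuple_rcons_max_last tuple_rcons_max_lift ltn_ord.
Qed.

(** The bound on [q] cannot be dropped: for k = 0 and q > M + 1 the left-hand
    side is an empty sum while P_{0,q,M} = 1. *)
Lemma multiple_sum_recr (C : comNzRingType) (a : nat -> nat -> C)
    (k q M : nat) :
  (q <= M.+1)%N ->
  multiple_sum a k.+1 q M.+1 =
    a k.+1 M.+1 * multiple_sum a k q M + multiple_sum a k.+1 q M.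
Proof.
move=> leqM; rewrite /multiple_sum.
rewrite (bigID (fun N : {ffun 'I_k.+1 -> 'I_M.+2} => N ord_max == ord_max)) /=.
congr (_ + _).
- rewrite (reindex_onto (tuple_rcons_max k M) (tuple_belast k M)) /=; last first.
    by move=> N /andP[incN /eqP]; exact: tuple_belastK incN.
  rewrite big_distrr /=; apply: eq_big => [N | N _].
    rewrite tuple_rcons_maxK tuple_rcons_max_last !eqxx !andbT.
    exact: increasing_rcons_max.
  rewrite big_ord_recr /= tuple_rcons_max_last mulrC; congr (_ * _).
  apply: eq_bigr => j _; rewrite -(tuple_rcons_max_lift k M N).
  by congr (a _ (tuple_rcons_max k M N _)); apply/val_inj; rewrite [RHS]lift_max.
- rewrite (reindex_onto (tuple_widen k.+1 M) (tuple_narrow k.+1 M)) /=; last first.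
    by move=> N /andP[incN]; exact: tuple_narrowK incN.
  apply: eq_big => [N | N _]; last by apply: eq_bigr => j _; rewrite ffunE.
  rewrite tuple_widenK eqxx andbT -[LHS]/(increasing_from q k.+1 M.+1 _ && _).
  rewrite increasing_widen ffunE.
  have -> : widen_ord (leqnSn M.+1) (N ord_max) != ord_max.
    by apply/eqP=> /(congr1 val) /= eqM; have := ltn_ord (N ord_max);
      rewrite eqM ltnn.
  by rewrite andbT.
Qed.

(** The hypothesis gives q <= n - m + 1, so that every upper bound met from the
    innermost level outwards is large enough for the recurrence. *)
Lemma nested_sumE (C : comNzRingType) (a : nat -> nat -> C) (m q n p d : nat) :
  (q + m <= n.+1)%N ->
  nested_sum a m q n p d = multiple_sum a (p + d) q (n.+1 - m + (p + d)).
Proof.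
move=> hn; elim: d => [|d IHd] /=; first by rewrite addn0.
rewrite IHd !addnS multiple_sum_recr //.
by rewrite ltnW // ltnS (leq_trans _ (leq_addr _ _)) // leq_subRL ?(addnC m) //
  (leq_trans (leq_addl q m)).
Qed.

Theorem theorem2p4 (R : realType) (m q n p : nat) (a : nat -> nat -> R[i])
  (hn : (q + m <= n.+1)%N) (hp : (p <= m)%N) :
  multiple_sum a m q n.+1 = nested_sum a m q n p (m - p)%N.
Proof.
by rewrite nested_sumE // subnKC // subnK // (leq_trans (leq_addl q m)).
Qed.
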